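(* Let $n\in\mathbb{N}$ be odd. For a ring $R$, the following conditions are equivalent: (1) $R$ is a strongly $n$-torsion clean ring; (2) there exist integers $k_1,\dots,k_t\geq 1$ such that $n=\mathrm{LCM}(2^{k_1}-1,\ldots,2^{k_t}-1)$ and $R$ is a subdirect product of copies of the fields $\mathbb{F}_{2^{k_i}}$, $1\leq i\leq t$; (3) $R$ is a clean ring in which the orders of all units are odd and bounded by $n$, and there exists a unit of order $n$.
   Context: All rings are associative with identity; $\mathbb{F}_m$ is the field with $m$ elements. A ring is clean if every element is a sum of an idempotent and a unit. A ring $R$ is strongly $n$-torsion clean if every $r\in R$ can be written $r=e+u$ with $e^2=e$, $u$ a unit, $u^n=1$ and $eu=ue$, and $n$ is the smallest natural number with this property. *)

(* Defs.v *)
From HB Require Import structures.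
From mathcomp Require Import all_boot all_order all_algebra all_field.
Set Implicit Arguments. Unset Strict Implicit. Unset Printing Implicit Defensive.
Import GRing.Theory.
Local Open Scope ring_scope.

Definition idempotent_el (R : nzRingType) (e : R) : Prop := e * e = e.

Definition is_unit (R : nzRingType) (u : R) : Prop :=
  exists v : R, u * v = 1 /\ v * u = 1.

Definition clean_ring (R : nzRingType) : Prop :=
  forall r : R, exists e u : R, idempotent_el e /\ is_unit u /\ r = e + u.

Definition sntc_prop (R : nzRingType) (n : nat) : Prop :=
  forall r : R, exists e u : R,
    [/\ idempotent_el e, is_unit u, u ^+ n = 1, e * u = u * e & r = e + u].

Definition strongly_n_torsion_clean (R : nzRingType) (n : nat) : Prop :=
  [/\ (0 < n)%N, sntc_prop R n & forall m : nat, (0 < m)%N -> sntc_prop R m -> (n <= m)%N].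

Definition unit_order (R : nzRingType) (u : R) (m : nat) : Prop :=
  [/\ (0 < m)%N, u ^+ m = 1 & forall j : nat, (0 < j)%N -> u ^+ j = 1 -> (m <= j)%N].

(* R is a subdirect product of the family of rings F : I -> finFieldType:
   there are surjective ring morphisms R -> F i which are jointly injective
   (i.e. the induced map R -> prod_i F i is an injective ring morphism whose
   compositions with the projections are surjective). *)
Definition subdirect_product (R : nzRingType) (I : Type) (F : I -> finFieldType)
  (phi : forall i, {rmorphism R -> F i}) : Prop :=
  (forall i (y : F i), exists x : R, phi i x = y) /\
  (forall x : R, (forall i, phi i x = 0) -> x = 0).

Definition lcm_mersenne (ks : seq nat) : nat :=
  \big[lcmn/1%N]_(k <- ks) (2 ^ k - 1)%N.

Definition cond2 (R : nzRingType) (n : nat) : Prop :=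
  exists ks : seq nat,
    [/\ ks != [::], all (fun k => 0 < k)%N ks, n = lcm_mersenne ks &
      exists (I : Type) (F : I -> finFieldType) (phi : forall i, {rmorphism R -> F i}),
        [/\ subdirect_product phi,
            forall i, exists2 k, k \in ks & #|F i| = (2 ^ k)%N &
            forall k, k \in ks -> exists i, #|F i| = (2 ^ k)%N]].

Definition cond3 (R : nzRingType) (n : nat) : Prop :=
  [/\ clean_ring R,
      forall u : R, is_unit u -> exists m, [/\ unit_order u m, odd m & (m <= n)%N] &
      exists u : R, is_unit u /\ unit_order u n].

(* Main.v *)
Require Import Defs.
From HB Require Import structures.
From mathcomp Require Import all_boot all_order all_algebra all_field.
From mathcomp Require Import cyclic boolp classical_sets.
Set Implicit Arguments. Unset Strict Implicit. Unset Printing Implicit Defensive.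
Import GRing.Theory.
Local Open Scope ring_scope.

(** If every r in R is e + u with e idempotent, u^N = 1, eu = ue and N odd, then
    decomposing 0 gives 2 = 0, so with q = 2^phi(N), which is 1 mod N, Frobenius
    yields r^q = e^q + u^q = e + u = r.  A ring satisfying x^q = x is reduced, so
    its idempotents are central; for x <> 0, the quotient by an ideal maximal
    among those avoiding the idempotent x^(q-1) is a division ring with y^q = y,
    which is a finite field by Herstein's proof of Jacobson's theorem.  Hence R is
    a subdirect product of finitely many types of fields F_{2^k}.  For such a
    product, L = LCM(2^k - 1) is both the least torsion-clean exponent (if
    F_{2^k} is the union of {0, 1} + (m-torsion units), then 2^k - 1 divides m)
    and the largest order of a unit.  A clean ring whose units have odd bounded
    orders is reduced of characteristic 2, hence satisfies the first hypothesis
    for some odd N; in each case n = L because both are the same extremum. *)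

(** * Quotient rings and finite subrings *)

Section QuotientRing.
Local Open Scope quotient_scope.
Variables (R : nzRingType) (I : zmodClosed R).
Hypothesis IMl : forall a x, x \in I -> a * x \in I.
Hypothesis IMr : forall a x, x \in I -> x * a \in I.
Hypothesis I1 : 1 \notin I.

Local Notation Q := (Quotient.quot I).
(** The product is computed on the representatives chosen by [repr]; [qmulE] shows that the choice
    is immaterial, since [I] absorbs factors on both sides. *)
Definition quot_mul (x y : Q) : Q := \pi_Q (repr x * repr y).

Let pi_eq (x y : R) : (\pi_Q x == \pi_Q y) = (x - y \in I).
Proof. by rewrite Quotient.idealrBE. Qed.

Let qmulE x y : quot_mul (\pi_Q x) (\pi_Q y) = \pi_Q (x * y).
Proof.
apply/eqP; rewrite pi_eq.
rewrite -[_ * repr _](addrNK (x * repr (\pi_Q y))) -mulrBl -addrA -mulrBr.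
by rewrite rpredD //; [apply: IMr | apply: IMl]; rewrite -pi_eq reprK.
Qed.

Let pi_surj (y : Q) : exists x, y = \pi_Q x.
Proof. by exists (repr y); rewrite reprK. Qed.

Let qmulA : associative quot_mul.
Proof. move=> x y z; have [[[a ->] [b ->]] [c ->]] := (pi_surj x, pi_surj y, pi_surj z).
by rewrite !qmulE mulrA. Qed.
Let qmul1l : left_id (\pi_Q 1) quot_mul.
Proof. by move=> x; have [a ->] := pi_surj x; rewrite qmulE mul1r. Qed.
Let qmul1r : right_id (\pi_Q 1) quot_mul.
Proof. by move=> x; have [a ->] := pi_surj x; rewrite qmulE mulr1. Qed.
Let qmulDl : left_distributive quot_mul +%R.
Proof.
move=> x y z; have [[[a ->] [b ->]] [c ->]] := (pi_surj x, pi_surj y, pi_surj z).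
by rewrite -raddfD !qmulE mulrDl raddfD.
Qed.
Let qmulDr : right_distributive quot_mul +%R.
Proof.
move=> x y z; have [[[a ->] [b ->]] [c ->]] := (pi_surj x, pi_surj y, pi_surj z).
by rewrite -raddfD !qmulE mulrDr raddfD.
Qed.
Let qone_neq0 : \pi_Q 1 != 0.
Proof. by rewrite -(raddf0 \pi_Q) pi_eq subr0. Qed.

Lemma quotient_ring_exists : exists (D : nzRingType) (f : {rmorphism R -> D}),
  (forall y, exists x, f x = y) /\ (forall x, (f x == 0) = (x \in I)).
Proof.
pose D : nzRingType := HB.pack Q
  (GRing.Zmodule_isNzRing.Build Q qmulA qmul1l qmul1r qmulDl qmulDr qone_neq0).
pose f : R -> D := \pi_Q.
have fB : zmod_morphism f by move=> x y; rewrite /f raddfB.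
have fM : monoid_morphism f by split=> // x y; rewrite /f -qmulE.
pose F : {rmorphism R -> D} := HB.pack f
  (GRing.isZmodMorphism.Build R D f fB) (GRing.isMonoidMorphism.Build R D f fM).
exists D, F; split=> [y|x]; first by exists (repr y); rewrite /F /= /f reprK.
by rewrite -[x in RHS]subr0 -pi_eq raddf0.
Qed.
End QuotientRing.


(** Wedderburn's little theorem: the elements of [s] form a finite ring without zero divisors, and
    [FinDomainFieldType] makes it a field, commutativity included. *)
Lemma finite_subring_field (D : nzRingType) (s : seq D) :
  subring_closed (mem s) -> (forall x y : D, x * y = 0 -> x = 0 \/ y = 0) ->
  exists (F : finFieldType) (f : {rmorphism F -> D}),
    forall x, x \in s <-> exists y, f y = x.
Proof.
move=> s_ring s_dom.
pose r : GRing.SubNzRing.type (mem s) := HB.pack (seq_sub s)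
  (GRing.SubChoice_isSubNzRing.Build D (mem s) (seq_sub s) s_ring).
pose fr : FinRing.NzRing.type := HB.pack (seq_sub s) (GRing.NzRing.class r) (Finite.class (seq_sub s)).
pose fu : finUnitRingType := HB.pack (seq_sub s) (FinRing.NzRing.class fr) (FinRing.isNzRing.Build fr).
have valM (x y : fu) : ssval (x * y) = ssval x * ssval y by exact: (rmorphM (val : r -> D)).
have valB (x y : fu) : ssval (x - y) = ssval x - ssval y by exact: (rmorphB (val : r -> D)).
have val1 : ssval (1 : fu) = 1 by exact: (rmorph1 (val : r -> D)).
have val0 : ssval (0 : fu) = 0 by exact: (rmorph0 (val : r -> D)).
have dom : GRing.integral_domain_axiom fu.
  move=> x y /(congr1 (@ssval _ _)); rewrite valM val0 => /s_dom.
  by case=> h; apply/orP; [left|right]; apply/eqP/val_inj/(etrans h)/esym/val0.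
pose F := FinDomainFieldType dom.
pose f : F -> D := @ssval _ _.
pose f' : {rmorphism F -> D} := HB.pack f (GRing.isZmodMorphism.Build F D f valB)
  (GRing.isMonoidMorphism.Build F D f (conj val1 valM)).
exists F, f' => x; split=> [xs|[y <-]]; last exact: ssvalP.
by exists (SeqSub xs).
Qed.

(** Powers of [b] move to the right past coefficients from [s], and b^N = 1, so the finitely many
    sums of g_i b^i with i < N are closed under products. The condition b k = k' b, weaker than
    commutation, is what Herstein's argument provides. *)
Lemma finite_subring_adjoin (D : nzRingType) (s : seq D) (b : D) (N : nat) :
    subring_closed (mem s) -> (0 < N)%N -> b ^+ N = 1 ->
    (forall k, k \in s -> exists2 k', k' \in s & b * k = k' * b) ->
  exists s' : seq D, [/\ subring_closed (mem s'), {subset s <= s'}, b \in s' &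
    forall x, x \in s' -> exists2 g : nat -> D,
      (forall i, g i \in s) & x = \sum_(i < N) g i * b ^+ i].
Proof.
move=> s_ring N_gt0 bN norm_b.
pose S : subringClosed D := HB.pack (fun x => x \in s)
  (GRing.isSubringClosed.Build D (fun x => x \in s) s_ring).
have SE x : (x \in s) = (x \in S) by [].
pose ev (g : {ffun 'I_N -> seq_sub s}) : D := \sum_i ssval (g i) * b ^+ i.
have evP x : reflect (exists2 g : nat -> D,
      (forall i, g i \in s) & x = \sum_(i < N) g i * b ^+ i) (x \in codom ev).
  apply: (iffP codomP) => [[g ->]|[g gs ->]].
    (* Outside ['I_N] the coefficient defaults to 0, an element of [s]. *)
    exists (fun i => if insub i is Some j then ssval (g j) else 0) => [i|].
      by case: insub => [j|]; [exact: ssvalP | rewrite SE rpred0].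
    by apply: eq_bigr => i _; rewrite valK.
  exists [ffun i : 'I_N => SeqSub (gs i)].
  by apply: eq_bigr => i _; rewrite ffunE.
have sB x y : x \in codom ev -> y \in codom ev -> x - y \in codom ev.
  move=> /evP[g gs ->] /evP[h hs ->]; apply/evP; exists (fun i => g i - h i).
    by move=> i; rewrite SE rpredB -?SE.
  by rewrite -sumrB; apply: eq_bigr => i _; rewrite mulrBl.
have sX k j : k \in s -> k * b ^+ j \in codom ev.
  move=> ks; apply/evP; exists (fun i => if i == (j %% N)%N then k else 0).
    by move=> i; case: ifP => // _; rewrite SE rpred0.
  rewrite (bigD1 (Ordinal (ltn_pmod j N_gt0))) //= eqxx big1 ?addr0.
    by rewrite {1}(divn_eq j N) exprD mulnC exprM bN expr1n mul1r.
  by move=> i /negPf; rewrite -val_eqE /= => ->; rewrite mul0r.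
have s0 : 0 \in codom ev by rewrite -[0](mul0r (b ^+ 0)) sX // SE rpred0.
pose Z : zmodClosed D := HB.pack (fun x => x \in codom ev)
  (GRing.isZmodClosed.Build D (fun x => x \in codom ev) (conj s0 sB)).
have ZE x : (x \in codom ev) = (x \in Z) by [].
have norm_bX i k : k \in s -> exists2 k', k' \in s & b ^+ i * k = k' * b ^+ i.
  elim: i k => [|i IHi] k ks; first by exists k; rewrite // mul1r mulr1.
  have [k1 k1s e1] := norm_b k ks; have [k2 k2s e2] := IHi k1 k1s.
  by exists k2 => //; rewrite exprSr -mulrA e1 mulrA e2 -mulrA.
exists (codom ev); split; last by move=> x /evP.
- split=> //; first by rewrite -[1](mul1r (b ^+ 0)) sX // SE rpred1.
  move=> x y /evP[g gs ->] /evP[h hs ->]; rewrite mulr_suml.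
  change (\sum_(i < N) g i * b ^+ i * (\sum_(i0 < N) h i0 * b ^+ i0) \in Z).
  apply: rpred_sum => i _; rewrite mulr_sumr; apply: rpred_sum => j _.
  have [k ks e] := norm_bX i (h j) (hs j).
  by rewrite mulrA -(mulrA (g i)) e mulrA -mulrA -exprD -ZE sX // SE rpredM -?SE.
- by move=> k ks; rewrite -[k]mulr1 -[1](expr0 b) sX.
- by rewrite -[b]mul1r -{1}[b]expr1 sX // SE rpred1.
Qed.

(** * Iterated commutators and eigenvectors *)

(** Left and right multiplication by [a] commute, so in characteristic 2 the square of their
    difference is the difference of their squares; each induction step doubles the exponent. *)
Lemma iter_commutator_char2 (D : nzRingType) (a x : D) (m : nat) :
  2 \in [pchar D] ->
  iter (2 ^ m) (fun y => a * y - y * a) x = a ^+ (2 ^ m) * x - x * a ^+ (2 ^ m).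
Proof.
move=> char2; elim: m x => [|m IHm] x //.
rewrite expnS mul2n -addnn iterD !IHm exprD; move: (a ^+ _) => c.
rewrite !(oppr_pchar2 char2) mulrDr mulrDl !mulrA [X in _ + X]addrC addrACA.
by rewrite (addrr_pchar2 char2) addr0.
Qed.

Section Eigenvector.
Variables (D : nzRingType) (F : finFieldType) (f : {rmorphism F -> D}) (d : D -> D).
Hypothesis dB : forall x y, d (x - y) = d x - d y.
Hypothesis d_lin : forall k x, d (f k * x) = f k * d x.

(** This is p(d) applied to [c], with [f] carrying the coefficients into [D]. The explicit length
    [n] lets polynomials of different sizes be subtracted termwise. *)
Let ev (c : D) n (p : {poly F}) := \sum_(i < n) f p`_i * iter i d c.

Let d0 : d 0 = 0. Proof. by have := dB 0 0; rewrite !subrr. Qed.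
Let dN x : d (- x) = - d x. Proof. by rewrite -sub0r dB d0 sub0r. Qed.
Let dD x y : d (x + y) = d x + d y.
Proof. by rewrite -{1}[y]opprK dB dN opprK. Qed.

Let ev_XsubC c n (p : {poly F}) l : (size p <= n)%N ->
  d (ev c n p) - f l * ev c n p = ev c n.+1 (('X - l%:P) * p).
Proof.
move=> sz_p; rewrite /ev (big_morph d dD d0).
under [RHS]eq_bigr => i _ do
  rewrite mulrBl coefB coefXM coefCM rmorphB mulrBl rmorphM -mulrA.
rewrite sumrB -mulr_sumr; congr (_ - f l * _).
  rewrite big_ord_recl /= rmorph0 mul0r add0r.
  by apply: eq_bigr => i _; rewrite d_lin.
by rewrite big_ord_recr /= nth_default // rmorph0 mul0r addr0.
Qed.

Let T l x := d x - f l * x.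

Let foldr_ev c rs :
  foldr T c rs = ev c (size rs).+1 (\prod_(l <- rs) ('X - l%:P)).
Proof.
elim: rs => [|l rs IHrs] /=.
  by rewrite /ev big_ord1 big_nil coefC rmorph1 mul1r.
by rewrite IHrs big_cons -ev_XsubC // size_prod_XsubC.
Qed.

Let evB c n p q : ev c n (p - q) = ev c n p - ev c n q.
Proof.
by rewrite -sumrB; apply: eq_bigr => i _; rewrite coefB rmorphB mulrBl.
Qed.

Let ev_Xn c n j : (j < n)%N -> ev c n 'X^j = iter j d c.
Proof.
move=> ltjn; rewrite /ev (bigD1 (Ordinal ltjn)) //= coefXn eqxx rmorph1 mul1r.
rewrite big1 ?addr0 // => i /negPf; rewrite -val_eqE /= coefXn => ->.
by rewrite rmorph0 mul0r.
Qed.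

(** When the factors d - l are applied to [c] one after another, the first one with output 0 has a
    nonzero input, which is an eigenvector. *)
Let foldr_eq0 c rs : c != 0 -> foldr T c rs = 0 ->
  exists2 l, l \in rs & exists2 x, x != 0 & d x = f l * x.
Proof.
move=> nz_c; elim: rs => [/eqP|l rs IHrs] /=; first by rewrite (negPf nz_c).
have [/IHrs[l' rs_l' ex] _|nz /eqP] := eqVneq (foldr T c rs) 0.
  by exists l'; rewrite ?inE ?rs_l' ?orbT.
by rewrite subr_eq0 => /eqP e; exists l; rewrite ?mem_head //; exists (foldr T c rs).
Qed.

(* X^#|F| - X splits over F, so d composed with all d - l, l != 0, kills c. *)
Lemma nonzero_eigenvector c : d c != 0 -> iter #|F| d c = d c ->
  exists2 l, l != 0 & exists2 x, x != 0 & d x = f l * x.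
Proof.
move=> nz_dc dFc; pose rs := [seq l <- enum F | l != 0].
have T_0 : T 0 c = d c by rewrite /T rmorph0 mul0r subr0.
have [|l l_rs ex] := @foldr_eq0 (d c) rs nz_dc.
- rewrite -T_0 -foldr_rcons foldr_ev.
  have perm_rs : perm_eq (rcons rs 0) (enum F).
    apply: uniq_perm; rewrite ?enum_uniq // ?rcons_uniq.
      by rewrite filter_uniq ?enum_uniq // mem_filter eqxx.
    by move=> l; rewrite mem_rcons inE mem_filter mem_enum; case: eqVneq.
  rewrite (perm_size perm_rs) (perm_big _ perm_rs) big_enum -finField_genPoly.
  rewrite -cardE evB ev_Xn // -['X]expr1 ev_Xn ?ltnS; last exact/ltnW/finNzRing_gt1.
  by rewrite /= dFc subrr.
- by move: l_rs; rewrite mem_filter => /andP[nz_l _]; exists l.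
Qed.
End Eigenvector.

(** * Division rings of characteristic 2 with x^N = 1 are finite fields *)

Lemma char2_subring01 (D : nzRingType) :
  2 \in [pchar D] -> subring_closed (mem [:: 0; 1 : D]).
Proof.
move=> char2; split; first by rewrite !inE eqxx orbT.
  move=> x y; rewrite !inE => /orP[]/eqP-> /orP[]/eqP->;
    by rewrite ?subr0 ?subrr ?sub0r ?(oppr_pchar2 char2) eqxx ?orbT.
move=> x y; rewrite !inE => /orP[]/eqP-> /orP[]/eqP->;
  by rewrite ?mul0r ?mulr0 ?mulr1 eqxx ?orbT.
Qed.

(** The nonzero elements are roots of X^N - 1, which has at most N of them; zero adds one more. *)
Lemma finField_card_exp_bound (F : finFieldType) (N : nat) : (0 < N)%N ->
  (forall x : F, x != 0 -> x ^+ N = 1) -> (#|F| <= N.+1)%N.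
Proof.
move=> N_gt0 expN; rewrite -(prednK (ltnW (finNzRing_gt1 F))) ltnS -(cardC1 (0 : F)) cardE.
apply: max_unity_roots => //; last exact: enum_uniq.
by apply/allP => x; rewrite mem_enum unity_rootE !inE => /expN->.
Qed.

Section PowerDivisionRing.
Variables (D : nzRingType) (N : nat).
Hypotheses (char2 : 2 \in [pchar D]) (N_gt0 : (0 < N)%N).
Hypothesis expN : forall x : D, x != 0 -> x ^+ N = 1.

Lemma power_division_dom (x y : D) : x * y = 0 -> x = 0 \/ y = 0.
Proof.
move=> xy0; have [->|nz_x] := eqVneq x 0; [by left | right].
by rewrite -[y]mul1r -(expN nz_x) -(prednK N_gt0) exprSr -mulrA xy0 mulr0.
Qed.

(* Herstein's argument: if a is not central, ad a has an eigenvector b for a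
   nonzero eigenvalue in the finite field K = F_2[a]; then b normalises K, so
   K and b generate a finite domain, which contradicts Wedderburn's theorem. *)
Lemma power_division_mulC (x y : D) : x * y = y * x.
Proof.
have [//|] := eqVneq (x * y) (y * x); move: x y => a c; rewrite -subr_eq0 => nz_ac.
have nz_a : a != 0 by apply: contraNneq nz_ac => ->; rewrite mul0r mulr0 subrr.
have s01 := char2_subring01 char2.
(* [s1] lists F_2[a]: the scalars 0 and 1 commute with [a]. *)
have [|s1 [s1_ring s01_s1 a_s1 s1P]] :=
    finite_subring_adjoin s01 N_gt0 (expN nz_a).
  move=> k; rewrite !inE => k01; exists k; rewrite ?inE //.
  by case/orP: k01 => /eqP->; rewrite ?mulr0 ?mul0r ?mulr1 ?mul1r.
have [K [f fP]] := finite_subring_field s1_ring power_division_dom.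
have [al e_al] : exists al, f al = a by apply/fP.
have char2K : 2 \in [pchar K] by rewrite -(fmorph_pchar f).
have cardK : #|K| = (2 ^ logn 2 #|K|)%N := card_pprimeChar char2K.
have aK : a ^+ #|K| = a by rewrite -e_al -rmorphXn expf_card.
pose d y := a * y - y * a.
(* The map ad a is K-linear because [a] lies in the commutative K, and its |K|-th iterate is
   ad(a^|K|) = ad a because |K| is a power of 2. *)
have [||||l nz_l [b nz_b]] := @nonzero_eigenvector D K f d _ _ c.
- move=> x y; rewrite /d mulrBr mulrBl !opprB !addrA.
  by rewrite [LHS]addrAC (addrAC (a * x) (- (a * y))) [LHS]addrAC.
- move=> k x; rewrite /d mulrBr !mulrA; congr (_ - _).
  by rewrite -e_al -!rmorphM mulrC.
- by [].
- by rewrite {1}cardK /d iter_commutator_char2 // -cardK aK.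
(* The eigenvector equation ab - ba = lb says that moving [b] to the right past [a] turns [a] into a
   - l. *)
rewrite /d => ab; have {}ab : b * a = (a - f l) * b by rewrite mulrBl -ab subKr.
have baX i : b * a ^+ i = (a - f l) ^+ i * b.
  elim: i => [|i IHi]; first by rewrite mulr1 mul1r.
  by rewrite exprSr mulrA IHi -mulrA ab mulrA -exprSr.
have [|s2 [s2_ring s12 b_s2 _]] :=
    finite_subring_adjoin s1_ring N_gt0 (expN nz_b).
  move=> _ /s1P[g g01 ->].
  have /fin_all_exists[h hP] (i : 'I_N) : exists h, f h = g i.
    by apply/fP/s01_s1.
  (* An element of K is a polynomial in [a] over F_2; substituting a - l for [a] gives the
     coefficient needed, again in K. *)
  exists (\sum_(i < N) g i * (a - f l) ^+ i).
    apply/fP; exists (\sum_(i < N) h i * (al - l) ^+ i); rewrite rmorph_sum.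
    by apply: eq_bigr => i _; rewrite rmorphM rmorphXn rmorphB e_al hP.
  rewrite mulr_sumr mulr_suml; apply: eq_bigr => i _; rewrite -mulrA -baX mulrA.
  rewrite mulrA; congr (_ * _); have := g01 i; rewrite !inE.
  by case/orP=> /eqP->; rewrite ?mulr0 ?mul0r ?mulr1 ?mul1r.
have [E [g gP]] := finite_subring_field s2_ring power_division_dom.
have [[u e_u] [v e_v]] : (exists u, g u = a) /\ (exists v, g v = b).
  by split; apply/gP => //; apply: s12.
(* Both [a] and [b] lie in the field E, so they commute and lb = ab - ba = 0. *)
have /eqP : f l * b = 0.
  by rewrite -[f l](subKr a) mulrBl -ab -e_u -e_v -!rmorphM mulrC subrr.
move=> /eqP/power_division_dom[/eqP|/eqP]; last by rewrite (negPf nz_b).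
by rewrite fmorph_eq0 (negPf nz_l).
Qed.

Let subring_seq_bound (s : seq D) : subring_closed (mem s) -> (size (undup s) <= N.+1)%N.
Proof.
move=> s_ring; have [F [f fP]] := finite_subring_field s_ring power_division_dom.
apply: leq_trans (finField_card_exp_bound N_gt0 (F := F) _); last first.
  move=> x nz_x; apply: (fmorph_inj f); rewrite rmorphXn rmorph1 expN //.
  by rewrite fmorph_eq0.
rewrite -(size_codom f) uniq_leq_size ?undup_uniq // => x.
by rewrite mem_undup => /fP[y <-]; apply: codom_f.
Qed.

(** As long as a finite subring misses an element, adjoining it gives a strictly larger one,
    commutativity being known by now. No finite subring has more than N + 1 elements, so the growth
    stops with all of [D]. *)
Let full_subring_seq : exists s : seq D, subring_closed (mem s) /\ forall x, x \in s.
Proof.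
have step j : exists s : seq D, subring_closed (mem s) /\
    ((forall x, x \in s) \/ (j <= size (undup s))%N).
  elim: j => [|j [s [s_ring [s_full|sz_s]]]]; last 1 first.
  - have [s_full|/existsNP[x /negP xNs]] := pselect (forall x, x \in s).
      by exists s; split; [|left].
    have nz_x : x != 0.
      by apply: contraNneq xNs => ->; case: s_ring => s1 sB _; rewrite -(subrr 1) sB.
    have [|s' [s'_ring ss' xs' _]] := finite_subring_adjoin s_ring N_gt0 (expN nz_x).
      by move=> k ks; exists k; rewrite // power_division_mulC.
    exists s'; split=> //; right; apply: leq_ltn_trans sz_s _.
    apply: (@uniq_leq_size _ (x :: undup s)).
      by rewrite /= mem_undup xNs undup_uniq.
    by move=> y; rewrite !inE !mem_undup => /predU1P[->|/ss'].
  - exists [:: 0; 1]; split; last by right.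
    exact: char2_subring01.
  - by exists s; split; [|left].
have [s [s_ring [s_full|]]] := step N.+2; first by exists s.
by rewrite ltnNge subring_seq_bound.
Qed.

Lemma power_division_finField : exists (F : finFieldType) (g : {rmorphism D -> F}),
  [/\ forall y, exists x, g x = y, forall x, g x = 0 -> x = 0 & (#|F| <= N.+1)%N].
Proof.
have [s [s_ring s_full]] := full_subring_seq.
have [F [f fP]] := finite_subring_field s_ring power_division_dom.
have /choice[g gK] x : exists y, f y = x by apply/fP.
have fK : cancel f g by move=> y; apply: (fmorph_inj f).
have gB : zmod_morphism g.
  by move=> x y; apply: (fmorph_inj f); rewrite rmorphB !gK.
have gM : monoid_morphism g.
  split=> [|x y]; apply: (fmorph_inj f); first by rewrite gK rmorph1.
  by rewrite rmorphM !gK.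
pose G : {rmorphism D -> F} := HB.pack g
  (GRing.isZmodMorphism.Build D F g gB) (GRing.isMonoidMorphism.Build D F g gM).
exists F, G; split=> [y|x gx0|]; first by exists (f y); exact: fK.
  by rewrite -[x]gK [g x]gx0 rmorph0.
apply: finField_card_exp_bound N_gt0 _ => x nz_x; apply: (fmorph_inj f).
by rewrite rmorphXn rmorph1 expN // fmorph_eq0.
Qed.
End PowerDivisionRing.

(** * Residue fields of rings with x^(N+1) = x *)

(** Both e x (1 - e) and (1 - e) x e square to zero, hence vanish, so ex = exe = xe. *)
Lemma reduced_idem_central (R : nzRingType) (e x : R) :
  (forall y : R, y * y = 0 -> y = 0) -> e * e = e -> e * x = x * e.
Proof.
move=> red ee.
have e1e : e * (1 - e) = 0 by rewrite mulrBr mulr1 ee subrr.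
have e1e' : (1 - e) * e = 0 by rewrite mulrBl mul1r ee subrr.
have h1 : e * x * (1 - e) = 0.
  by apply: red; rewrite !mulrA -(mulrA (e * x)) e1e' mulr0 !mul0r.
have h2 : (1 - e) * x * e = 0.
  by apply: red; rewrite !mulrA -(mulrA ((1 - e) * x)) e1e mulr0 !mul0r.
transitivity (e * x * e).
  by apply/eqP; rewrite -subr_eq0 -[X in X - _]mulr1 -mulrBr h1.
by apply/eqP; rewrite eq_sym -subr_eq0 -[X in X * e - _]mul1r -!mulrBl h2.
Qed.

Section ResidueFields.
Variables (R : nzRingType) (N : nat).
Hypotheses (char2 : 2 \in [pchar R]) (N_gt0 : (0 < N)%N).
Hypothesis expSN : forall x : R, x ^+ N.+1 = x.

Let reduced (y : R) : y * y = 0 -> y = 0.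
Proof. by move=> yy0; rewrite -[y]expSN -(prednK N_gt0) !exprS mulrA yy0 mul0r. Qed.

Let idemXN (x : R) : x ^+ N * x ^+ N = x ^+ N.
Proof.
by rewrite -{1}(prednK N_gt0) exprSr -mulrA -exprS expSN -exprSr (prednK N_gt0).
Qed.

Let central (e x : R) : e * e = e -> e * x = x * e.
Proof. exact: reduced_idem_central. Qed.

Local Open Scope classical_set_scope.

(** Membership of 0 is not demanded, so that the empty set, the union of the empty chain in Zorn's
    lemma, qualifies; a maximal [A] does contain 0. *)
Let avoiding_ideal (e : R) (A : set R) : Prop :=
  [/\ forall x y, A x -> A y -> A (x - y),
      forall a x, A x -> A (a * x), forall a x, A x -> A (x * a) & ~ A e].

(** If [A] contains neither f nor 1 - f, both central, then by maximality [e] lies in A + fR and in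
    A + (1 - f)R. Multiplying the two expressions puts e = ee into [A], since f(1 - f) = 0. *)
Let maximal_ideal (e : R) : e * e = e -> e != 0 -> exists A : set R,
  [/\ avoiding_ideal e A, A 0 & forall f, f * f = f -> A f \/ A (1 - f)].
Proof.
move=> ee nz_e.
have [|A [idA maxA]] := @Zorn_bigcup R (avoiding_ideal e).
  move=> F idF totF; split.
  - move=> x y [X FX Xx] [Y FY Yy].
    have [XY|YX] := totF X Y FX FY.
      by exists Y => //; have [YB _ _ _] := idF Y FY; apply: YB => //; apply: XY.
    by exists X => //; have [XB _ _ _] := idF X FX; apply: XB => //; apply: YX.
  - by move=> a x [X FX Xx]; exists X => //; have [_ XM _ _] := idF X FX; apply: XM.
  - by move=> a x [X FX Xx]; exists X => //; have [_ _ XM _] := idF X FX; apply: XM.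
  - by move=> [X FX Xe]; have [_ _ _ ] := idF X FX.
have [AB AMl AMr ANe] := idA; exists A.
have A0 : A 0.
  have [[x Ax]|/forallNP A_empty] := pselect (exists x, A x).
    by rewrite -(subrr x); apply: AB.
  (* An empty [A] would be properly contained in the zero ideal, which avoids [e]. *)
  case: (maxA [set 0]).
    by split=> [x /A_empty//|/(_ 0 erefl)/A_empty].
  split=> [x y -> ->|a x ->|a x ->|/eqP]; rewrite /= ?subrr ?mulr0 ?mul0r //.
  exact/negP.
have AD x y : A x -> A y -> A (x + y).
  by move=> Ax Ay; rewrite -[y]opprK; apply: (AB) => //; rewrite -sub0r; apply: AB.
split=> //.
have extend f : f * f = f -> ~ A f -> exists x r, A x /\ e = x + f * r.
  move=> ff Af; apply: contrapT => noxr.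
  pose B := [set y | exists x r, A x /\ y = x + f * r].
  case: (maxA B).
    split=> [x Ax|BA]; first by exists x, 0; rewrite mulr0 addr0.
    by apply/Af/BA; exists 0, 1; rewrite mulr1 add0r.
  split=> //.
  - move=> _ _ [x [r [Ax ->]]] [y [t [Ay ->]]]; exists (x - y), (r - t).
    by split; [exact: AB | rewrite mulrBr opprD addrACA].
  - move=> a _ [x [r [Ax ->]]]; exists (a * x), (a * r); split; first exact: AMl.
    by rewrite mulrDr !mulrA (central _ ff).
  - move=> a _ [x [r [Ax ->]]]; exists (x * a), (r * a); split; first exact: AMr.
    by rewrite mulrDl !mulrA.
move=> f ff; have ff' : (1 - f) * (1 - f) = 1 - f.
  by rewrite mulrBl mul1r mulrBr mulr1 ff subrr subr0.
have [Af|/(extend f ff)[x [r [Ax ex]]]] := pselect (A f); first by left.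
have [Af|/(extend _ ff')[y [t [Ay ey]]]] := pselect (A (1 - f)); first by right.
exfalso; apply: ANe; rewrite -ee {1}ex ey mulrDl; apply: (AD); first exact: AMr.
rewrite mulrDr; apply: AD; first exact: AMl.
rewrite (central _ ff) mulrA -(mulrA r) mulrBr mulr1 ff subrr mulr0 mul0r.
exact: A0.
Qed.

Lemma residue_field_separates (x : R) : x != 0 ->
  exists (F : finFieldType) (phi : {rmorphism R -> F}),
    [/\ forall y, exists z, phi z = y, phi x != 0 & (#|F| <= N.+1)%N].
Proof.
move=> nz_x; have nz_e : x ^+ N != 0.
  by apply: contraNneq nz_x => e0; rewrite -[x]expSN exprS e0 mulr0.
have [A [[AB AMl AMr ANe] A0 Aidem]] := maximal_ideal (idemXN x) nz_e.
pose p : R -> bool := fun y => `[< A y >].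
have pP y : reflect (A y) (p y) by exact: asboolP.
have p_zmod : zmod_closed p.
  by split=> [|y z /pP Ay /pP Az]; apply/pP => //; apply: AB.
pose I : zmodClosed R := HB.pack p (GRing.isZmodClosed.Build R p p_zmod).
have IP y : reflect (A y) (y \in I) by exact: asboolP.
have [||| D [f [f_surj fE]]] := @quotient_ring_exists R I.
- by move=> a y /IP Ay; apply/IP/AMl.
- by move=> a y /IP Ay; apply/IP/AMr.
- by apply/negP => /IP /(AMl (x ^+ N)); rewrite mulr1.
(* The ideal contains z^N or 1 - z^N. In the first case the image of z = z z^N would be 0, so z^N
   maps to 1. *)
have expN (y : D) : y != 0 -> y ^+ N = 1.
  have [z <-] := f_surj y => nz_fz; rewrite -rmorphXn.
  have [|] := Aidem (z ^+ N) (idemXN z) => /IP; rewrite -fE.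
    by rewrite rmorphXn => /eqP e0; case/eqP: nz_fz; rewrite -[z]expSN rmorphXn exprS e0 mulr0.
  by rewrite rmorphB rmorph1 subr_eq0 => /eqP.
have char2D : 2 \in [pchar D] := rmorph_pchar f char2.
have [F [g [g_surj g_inj cardF]]] := power_division_finField char2D N_gt0 expN.
exists F, (g \o f); split=> // [y|].
  by have [z <-] := g_surj y; have [t <-] := f_surj z; exists t.
apply/eqP => /g_inj fx0; apply: ANe; apply/IP; rewrite -fE rmorphXn fx0.
by rewrite expr0n eqn0Ngt N_gt0.
Qed.
End ResidueFields.

(** * Orders of units *)

Section Orders.
Variable R : nzRingType.
Implicit Types u v : R.

Lemma unit_order_dvd u m j : unit_order u m -> u ^+ j = 1 -> (m %| j)%N.
Proof.
move=> [m_gt0 um minm]; rewrite {1}(divn_eq j m) exprD mulnC exprM um expr1n mul1r.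
move=> uj; apply/eqP; case: (posnP (j %% m)) => // /minm/(_ uj).
by rewrite leqNgt ltn_pmod.
Qed.

Lemma unit_order_intro u m : (0 < m)%N -> u ^+ m = 1 ->
  (forall j, u ^+ j = 1 -> (m %| j)%N) -> unit_order u m.
Proof. by move=> m_gt0 um dvdm; split=> // j j_gt0 /dvdm; exact: dvdn_leq. Qed.

Lemma unit_order_exists u n : (0 < n)%N -> u ^+ n = 1 -> exists m, unit_order u m.
Proof.
move=> n_gt0 un.
have ex : exists m, (0 < m)%N && (u ^+ m == 1) by exists n; rewrite n_gt0 un eqxx.
case: (ex_minnP ex) => m /andP[m_gt0 /eqP um] minm.
by exists m; split=> // j j_gt0 uj; apply: minm; rewrite j_gt0 uj eqxx.
Qed.

Lemma unit_order_exp u a d : unit_order u a -> (d %| a)%N ->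
  unit_order (u ^+ (a %/ d)) d.
Proof.
move=> ord_u dvd_da; have [a_gt0 ua _] := ord_u.
have d_gt0 : (0 < d)%N := dvdn_gt0 a_gt0 dvd_da.
apply: unit_order_intro => // [|j]; rewrite -exprM ?divnK // => /(unit_order_dvd ord_u).
by rewrite -{1}(divnK dvd_da) dvdn_pmul2l // divn_gt0 // dvdn_leq.
Qed.

Lemma exp_eq1_is_unit u n : (0 < n)%N -> u ^+ n = 1 -> is_unit u.
Proof.
by move=> n_gt0 un; exists (u ^+ n.-1); rewrite -exprS -exprSr (prednK n_gt0).
Qed.

Hypothesis mulC : forall u v, u * v = v * u.

Lemma unit_order_mul u v a b : coprime a b ->
  unit_order u a -> unit_order v b -> unit_order (u * v) (a * b).
Proof.
move=> co_ab ord_u ord_v; have [a_gt0 ua _] := ord_u; have [b_gt0 vb _] := ord_v.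
have uvX j : (u * v) ^+ j = u ^+ j * v ^+ j by apply: exprMn_comm; exact: mulC.
apply: unit_order_intro => [||j uvj]; first by rewrite muln_gt0 a_gt0.
  by rewrite uvX exprM ua expr1n mulnC exprM vb expr1n mulr1.
rewrite Gauss_dvd //; apply/andP; split.
  rewrite -(Gauss_dvdl _ co_ab); apply: (unit_order_dvd ord_u).
  have := congr1 (fun w => w ^+ b) uvj; rewrite uvX exprMn_comm; last exact: mulC.
  by rewrite -!exprM [X in v ^+ X]mulnC (exprM v) vb !expr1n mulr1.
rewrite coprime_sym in co_ab; rewrite -(Gauss_dvdl _ co_ab).
apply: (unit_order_dvd ord_v).
have := congr1 (fun w => w ^+ a) uvj; rewrite uvX exprMn_comm; last exact: mulC.
by rewrite -!exprM [X in u ^+ X]mulnC (exprM u) ua !expr1n mul1r.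
Qed.

(** Let pi be the set of primes at which [a] has at least the valuation of [b]. The lcm is the
    product of the coprime numbers a_pi and b_pi', which are orders of powers of [u] and [v]. *)
Lemma unit_order_lcm u v a b : unit_order u a -> unit_order v b ->
  exists w : R, unit_order w (lcmn a b).
Proof.
move=> ord_u ord_v; have [a_gt0 _ _] := ord_u; have [b_gt0 _ _] := ord_v.
pose pi : nat_pred := [pred p | logn p b <= logn p a]%N.
have lcm_gt0 : (0 < lcmn a b)%N by rewrite lcmn_gt0 a_gt0.
have -> : lcmn a b = (a`_pi * b`_pi^')%N.
  rewrite -(partnC pi lcm_gt0); congr (_ * _)%N;
    apply: eq_partn_from_log => // p pi_p; rewrite /= logn_lcm //.
    by apply/maxn_idPl.
  by apply/maxn_idPr/ltnW; rewrite ltnNge.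
eexists; apply: unit_order_mul; first exact: coprime_partC.
  exact: unit_order_exp ord_u (dvdn_part _ _).
exact: unit_order_exp ord_v (dvdn_part _ _).
Qed.
End Orders.

(** * Torsion in finite fields and least common multiples of the numbers 2^k - 1 *)

Lemma exp_gcdn_eq1 (R : nzRingType) (x : R) m n : (0 < m)%N ->
  x ^+ m = 1 -> x ^+ n = 1 -> x ^+ gcdn m n = 1.
Proof.
move=> m_gt0 xm xn; have [a _ /dvdnP[c e]] := Bezoutl n m_gt0.
have := congr1 (fun k => x ^+ k) e.
by rewrite exprD mulnC exprM xn expr1n mulr1 mulnC exprM xm expr1n.
Qed.

Lemma expf_card_pred (F : finFieldType) (y : F) : y != 0 -> y ^+ #|F|.-1 = 1.
Proof.
move=> nz_y; apply: (mulfI nz_y).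
by rewrite mulr1 -exprS prednK ?expf_card // ltnW // finNzRing_gt1.
Qed.

(* The m-torsion of F^* and its translate by 1 cover F, hence the subgroup has
   more than half as many elements as F^*, so it is everything. *)
Lemma finField_torsion_cover (F : finFieldType) (m : nat) : (0 < m)%N ->
  (forall y : F, y ^+ m = 1 \/ (y - 1) ^+ m = 1) -> (#|F|.-1 %| m)%N.
Proof.
move=> m_gt0 cover; set M := #|F|.-1.
have F_gt1 := finNzRing_gt1 F; have FM : #|F| = M.+1 by rewrite prednK // ltnW.
have M_gt0 : (0 < M)%N by rewrite -ltnS -FM.
pose S := [set y : F | y ^+ m == 1].
have cardS : (#|S| <= gcdn m M)%N.
  (* An m-torsion element is also M-torsion, hence a root of X^gcd(m, M) - 1. *)
  rewrite cardE; apply: max_unity_roots; rewrite ?gcdn_gt0 ?m_gt0 ?enum_uniq //.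
  apply/allP => y; rewrite mem_enum inE unity_rootE => /eqP ym.
  rewrite exp_gcdn_eq1 // expf_card_pred //.
  by apply: contra_eq_neq ym => ->; rewrite expr0n eqn0Ngt m_gt0 eq_sym oner_neq0.
have : (#|F| <= #|S| + #|S|)%N.
  apply: leq_trans (leq_add (leqnn _) (leq_imset_card (+%R 1) S)).
  apply: leq_trans (leq_card_setU _ _); rewrite -cardsT subset_leq_card //.
  apply/fintype.subsetP => y _; rewrite finset.in_setU inE.
  have [->|y1m] := cover y; first by rewrite eqxx.
  by apply/orP; right; apply/imsetP; exists (y - 1); rewrite ?inE ?y1m // addrC subrK.
move=> /leq_trans/(_ (leq_add cardS cardS)); rewrite FM => ltM.
(* With M = c gcd(m, M) and M + 1 <= 2 gcd(m, M), the cofactor c can only be 1. *)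
have /dvdnP[c Mc] := dvdn_gcdr m M.
suff c1 : c = 1%N by rewrite Mc c1 mul1n dvdn_gcdl.
case: c Mc => [|[|c]] // Mc; first by rewrite Mc in M_gt0.
move: ltM; rewrite {1}Mc addnn -mul2n ltnNge; case/negP.
by rewrite leq_mul2r orbT.
Qed.

Lemma lcm_mersenne_sup ks k : k \in ks -> (2 ^ k - 1 %| lcm_mersenne ks)%N.
Proof.
rewrite /lcm_mersenne; elim: ks => // k' ks IHks; rewrite inE big_cons.
case/predU1P=> [->|/IHks]; first exact: dvdn_lcml.
by move/dvdn_trans; apply; exact: dvdn_lcmr.
Qed.

Lemma lcm_mersenne_ind (P : nat -> Prop) ks : P 1%N ->
  (forall a b, P a -> P b -> P (lcmn a b)) ->
  (forall k, k \in ks -> P (2 ^ k - 1)%N) -> P (lcm_mersenne ks).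
Proof.
move=> P1 Plcm Pks; rewrite /lcm_mersenne big_seq.
by apply: big_ind.
Qed.

Lemma primitive_unit_root_exists (F : finFieldType) :
  exists g : F, #|F|.-1.-primitive_root g.
Proof.
have /hasP[g _ prim_g] : has #|F|.-1.-primitive_root (enum (predC1 (0 : F))).
  apply: has_prim_root; rewrite ?enum_uniq //.
  - by rewrite -subn1 subn_gt0 finNzRing_gt1.
  - by apply/allP => y; rewrite mem_enum unity_rootE !inE => /expf_card_pred->.
  - by rewrite -cardE cardC1.
by exists g.
Qed.

(** * Subdirect products of finite fields of characteristic 2 *)

Lemma pchar2P (R : nzRingType) : 1 + 1 = 0 :> R -> 2 \in [pchar R].
Proof. by move=> e; rewrite inE /= mulr2n e eqxx. Qed.

Lemma lcm_mersenne_odd ks : all (fun k => 0 < k)%N ks -> odd (lcm_mersenne ks).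
Proof.
move=> ks_gt0; apply: (lcm_mersenne_ind (P := odd)) => // [a b odd_a odd_b|k].
  by apply: (@dvdn_odd _ (a * b)); rewrite ?oddM ?odd_a // dvdn_lcm dvdn_mulr ?dvdn_mull.
move=> /(allP ks_gt0) k_gt0; rewrite oddB ?expn_gt0 // oddX /=.
by case: k k_gt0.
Qed.

Section SubdirectProduct.
Variables (R : nzRingType) (ks : seq nat) (I : Type) (F : I -> finFieldType).
Variable phi : forall i, {rmorphism R -> F i}.
Hypothesis ks_gt0 : all (fun k => 0 < k)%N ks.
Hypothesis sub_phi : subdirect_product phi.
Hypothesis cardF : forall i, exists2 k, k \in ks & #|F i| = (2 ^ k)%N.
Hypothesis cardF_onto : forall k, k \in ks -> exists i, #|F i| = (2 ^ k)%N.

Let L := lcm_mersenne ks.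

Let sep (x y : R) : (forall i, phi i x = phi i y) -> x = y.
Proof.
move=> e; apply/eqP; rewrite -subr_eq0; apply/eqP/sub_phi.2 => i.
by rewrite rmorphB e subrr.
Qed.

Let L_gt0 : (0 < L)%N := odd_gt0 (lcm_mersenne_odd ks_gt0).

Let char2 i : 2 \in [pchar F i].
Proof. by have [k _ /card_finPcharP->] := cardF i. Qed.

Let expL i (y : F i) : y != 0 -> y ^+ L = 1.
Proof.
move=> nz_y; have [k ks_k cF] := cardF i.
have /dvdnP[c def_L] : (2 ^ k - 1 %| L)%N := lcm_mersenne_sup ks_k.
by rewrite def_L mulnC exprM subn1 -cF expf_card_pred // expr1n.
Qed.

Lemma subdirect_mulC (x y : R) : x * y = y * x.
Proof. by apply: sep => i; rewrite !rmorphM mulrC. Qed.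

Lemma subdirect_unit_exp (u : R) : is_unit u -> u ^+ L = 1.
Proof.
move=> [v [uv _]]; apply: sep => i; rewrite rmorphXn rmorph1 expL //.
apply/eqP => u0; have := congr1 (phi i) uv.
by rewrite rmorphM u0 mul0r rmorph1 => /eqP; rewrite eq_sym oner_eq0.
Qed.

(** In each coordinate x^L is 1 where [x] is nonzero and 0 elsewhere. Thus 1 - x^L is idempotent,
    and subtracting it replaces the zero coordinates of [x] by -1 = 1 and keeps the others. *)
Let uni (x : R) := x - (1 - x ^+ L).

Let phi_uni i x : phi i (uni x) = if phi i x == 0 then 1 else phi i x.
Proof.
rewrite !rmorphB rmorphXn rmorph1; case: eqP => [->|/eqP nz].
  by rewrite expr0n eqn0Ngt L_gt0 /= subr0 sub0r (oppr_pchar2 (char2 i)).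
by rewrite expL // subrr subr0.
Qed.

Let uniL x : uni x ^+ L = 1.
Proof.
apply: sep => i; rewrite rmorphXn phi_uni rmorph1.
by case: eqP => [_|/eqP/expL]; rewrite ?expr1n.
Qed.

Lemma subdirect_sntc : sntc_prop R L.
Proof.
move=> x; exists (1 - x ^+ L), (uni x); split=> //.
- apply: sep => i; rewrite rmorphM rmorphB rmorphXn rmorph1.
  have [->|/expL->] := eqVneq (phi i x) 0; last by rewrite subrr mul0r.
  by rewrite expr0n eqn0Ngt L_gt0 /= subr0 mulr1.
- exact: exp_eq1_is_unit L_gt0 (uniL x).
- exact: subdirect_mulC.
- by rewrite addrC subrK.
Qed.

(** The idempotent in a decomposition maps to 0 or 1 in each field, so every y there satisfies y^m =
    1 or (y - 1)^m = 1, and the covering bound applies. *)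
Lemma subdirect_sntc_dvd m : (0 < m)%N -> sntc_prop R m -> (L %| m)%N.
Proof.
move=> m_gt0 sntc_m; apply: (lcm_mersenne_ind (P := fun a => a %| m)%N) => //.
  by move=> a b am bm; rewrite dvdn_lcm am.
move=> k /cardF_onto[i cF]; rewrite subn1 -cF.
apply: finField_torsion_cover => // y; have [x <-] := sub_phi.1 i y.
have [e [u [ee _ um _ ->]]] := sntc_m x; rewrite rmorphD.
have /eqP := congr1 (phi i) um; rewrite rmorphXn rmorph1 => /eqP pum.
have : phi i e * (phi i e - 1) = 0.
  by rewrite mulrBr mulr1 -rmorphM ee subrr.
move/eqP; rewrite mulf_eq0 subr_eq0 => /orP[]/eqP->; first by left; rewrite add0r.
by right; rewrite addrC addKr.
Qed.

(** Lift a generator of the multiplicative group of F_{2^k} and make the lift a unit by [uni]. Its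
    order is a multiple of 2^k - 1, so some power has exactly this order; lcms of orders are again
    orders. *)
Lemma subdirect_order_exists : exists u : R, unit_order u L.
Proof.
apply: (lcm_mersenne_ind (P := fun a => exists u : R, unit_order u a)).
- by exists 1; split=> // j j_gt0.
- by move=> a b [u ord_u] [v ord_v]; apply: (unit_order_lcm subdirect_mulC ord_u ord_v).
move=> k /cardF_onto[i cF]; have [g prim_g] := primitive_unit_root_exists (F i).
have [x ex] := sub_phi.1 i g.
have nz_g : g != 0.
  apply: contra_eq_neq (prim_expr_order prim_g) => ->.
  by rewrite expr0n eqn0Ngt (prim_order_gt0 prim_g) eq_sym oner_neq0.
have phi_u : phi i (uni x) = g by rewrite phi_uni ex (negPf nz_g).
have [m ord_m] := unit_order_exists L_gt0 (uniL x).
have dvd_m : (2 ^ k - 1 %| m)%N.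
  rewrite subn1 -cF (prim_order_dvd prim_g) -phi_u -rmorphXn.
  by case: ord_m => _ -> _; rewrite rmorph1.
by eexists; apply: unit_order_exp ord_m dvd_m.
Qed.
End SubdirectProduct.

(** * Implications between the three conditions *)

Lemma cond2_sntc (R : nzRingType) n : cond2 R n -> strongly_n_torsion_clean R n.
Proof.
move=> [ks [_ ks_gt0 -> [I [F [phi [sub cF cF_onto]]]]]].
have L_gt0 := odd_gt0 (lcm_mersenne_odd ks_gt0); split=> //.
  exact: subdirect_sntc ks_gt0 sub cF.
move=> m m_gt0 /(subdirect_sntc_dvd sub cF_onto m_gt0).
exact: dvdn_leq.
Qed.

Lemma cond2_cond3 (R : nzRingType) n : odd n -> cond2 R n -> cond3 R n.
Proof.
move=> odd_n c2; have [n_gt0 sntc_n _] := cond2_sntc c2; split.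
- by move=> r; have [e [u [ee uu _ _ ->]]] := sntc_n r; exists e, u.
- case: c2 => [ks [_ ks_gt0 def_n [I [F [phi [sub cF _]]]]]] u uu.
  have un : u ^+ n = 1 by rewrite def_n (subdirect_unit_exp sub cF).
  have [m ord_m] := unit_order_exists n_gt0 un.
  have dvd_mn := unit_order_dvd ord_m un.
  by exists m; split; [|exact: dvdn_odd odd_n|exact: dvdn_leq].
case: c2 => [ks [_ ks_gt0 def_n [I [F [phi [sub cF cF_onto]]]]]].
have [u ord_u] := subdirect_order_exists ks_gt0 sub cF cF_onto.
rewrite -def_n in ord_u; exists u; split=> //; have [_ un _] := ord_u.
exact: exp_eq1_is_unit n_gt0 un.
Qed.

(** In 0 = e + u the idempotent e = -u is a unit, so e = 1 and u = -1; then (-1)^N = 1 with N odd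
    gives -1 = 1. *)
Lemma sntc_pchar2 (R : nzRingType) N : odd N -> sntc_prop R N -> 2 \in [pchar R].
Proof.
move=> odd_N sntc_N; have [e [u [ee [v [uv _]] uN _ /esym/eqP]]] := sntc_N 0.
rewrite addrC addr_eq0 => /eqP def_u.
have e1 : e = 1.
  rewrite -[e]mulr1 -uv def_u mulNr mulrN mulrA ee.
  by rewrite -mulNr -def_u uv.
apply: pchar2P; rewrite -{2}uN def_u e1 -signr_odd odd_N expr1 subrr //.
Qed.

Lemma exprD_char2_comm (R : nzRingType) (x y : R) m : 2 \in [pchar R] ->
  GRing.comm x y -> (x + y) ^+ (2 ^ m) = x ^+ (2 ^ m) + y ^+ (2 ^ m).
Proof.
move=> char2 cxy; elim: m => [|m IHm]; first by rewrite !expr1.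
rewrite expnSr !exprM IHm -!(pFrobenius_autE char2) pFrobenius_autD_comm //.
exact/commrX/commr_sym/commrX/commr_sym.
Qed.

Lemma sntc_exp (R : nzRingType) N (r : R) : odd N -> sntc_prop R N ->
  r ^+ (2 ^ totient N) = r.
Proof.
move=> odd_N sntc_N; have char2 := sntc_pchar2 odd_N sntc_N.
have [e [u [ee _ uN eu ->]]] := sntc_N r; rewrite exprD_char2_comm //.
have eX j : (0 < j)%N -> e ^+ j = e.
  by elim: j => // -[|j] IHj _; rewrite ?expr1 // exprS IHj.
rewrite eX ?expn_gt0 //; congr (_ + _).
have co : coprime 2 N by rewrite coprime2n.
have /eqP := Euler_exp_totient co.
rewrite eqn_mod_dvd ?expn_gt0 // => /dvdnP[c e2].
by rewrite -(subnK (expn_gt0 2 (totient N))) e2 exprD mulnC exprM uN expr1n mul1r.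
Qed.

Lemma sntc_cond2 (R : nzRingType) N : odd N -> sntc_prop R N -> exists L, cond2 R L.
Proof.
move=> odd_N sntc_N; have char2 := sntc_pchar2 odd_N sntc_N.
set q := (2 ^ totient N)%N; set M := q.-1.
have q_gt1 : (1 < q)%N by rewrite -(expn0 2) ltn_exp2l // totient_gt0 odd_gt0.
have qE : q = M.+1 by rewrite prednK // ltnW.
have M_gt0 : (0 < M)%N by rewrite -ltnS -qE.
have expM (x : R) : x ^+ M.+1 = x by rewrite -qE sntc_exp.
(* One residue field is chosen for each nonzero element, with that element surviving in it, which
   makes the family jointly injective. *)
pose J := {x : R | x != 0}.
have /choice[h hP] (j : J) : exists Fp : {F : finFieldType & {rmorphism R -> F}},
    [/\ forall y, exists z, projT2 Fp z = y, projT2 Fp (val j) != 0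
      & (#|projT1 Fp| <= M.+1)%N].
  have [F [p pP]] := residue_field_separates char2 M_gt0 expM (valP j).
  by exists (existT _ F p).
pose F j := projT1 (h j).
have cF j : exists2 k, (0 < k <= M)%N & #|F j| = (2 ^ k)%N.
  have char2F : 2 \in [pchar F j] := rmorph_pchar (projT2 (h j)) char2.
  have cardF : #|F j| = (2 ^ logn 2 #|F j|)%N := card_pprimeChar char2F.
  exists (logn 2 #|F j|) => //; have := finNzRing_gt1 (F j).
  rewrite {1}cardF -{1}(expn0 2) ltn_exp2l // => -> /=.
  (* The chain k < 2^k = |F j| <= M + 1 bounds the exponents uniformly in j. *)
  rewrite -ltnS; apply: leq_trans (ltn_expl _ (isT : 1 < 2)%N) _.
  by rewrite -cardF; case: (hP j).
(* Only exponents that occur are kept, so each entry of [ks] is realised by some field of the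
   family. *)
pose ks := [seq k <- iota 1 M | `[< exists j, #|F j| = (2 ^ k)%N >]].
have mem_ks k : (k \in ks) = `[< exists j, #|F j| = (2 ^ k)%N >] && (0 < k <= M)%N.
  by rewrite mem_filter mem_iota add1n ltnS.
have cF_ks j : exists2 k, k \in ks & #|F j| = (2 ^ k)%N.
  have [k k_bd cFk] := cF j; exists k; rewrite // mem_ks k_bd andbT.
  by apply/asboolP; exists j.
exists (lcm_mersenne ks), ks; split=> //.
(* The element 1 is nonzero, so the family has a member and [ks] an entry. *)
- have [k] := cF_ks (exist _ 1 (oner_neq0 R) : J).
  by case: ks {mem_ks cF_ks}.
- by apply/allP => k; rewrite mem_ks => /and3P[].
exists J, F, (fun j => projT2 (h j)); split=> //.
- split=> [j y|x phi_x]; first by case: (hP j) => + _ _; exact.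
  apply/eqP/negPn/negP => nz_x; have [_ /eqP + _] := hP (exist _ x nz_x).
  by apply; apply: phi_x.
- by move=> k; rewrite mem_ks => /andP[/asboolP].
Qed.

(** The product N of the odd numbers up to [n] is an odd multiple of every unit order, so u^N = 1
    for all units; u = -1 gives characteristic 2. If yy = 0, then (1 + y)^2 = 1, and N odd forces 1
    + y = 1. The ring is thus reduced, its idempotents are central, and every clean decomposition
    commutes. *)
Lemma cond3_sntc (R : nzRingType) n : cond3 R n -> exists2 N, odd N & sntc_prop R N.
Proof.
move=> [clean ordU _]; pose N := (\prod_(i < n.+1 | odd i) i)%N.
have odd_N : odd N by apply: (big_ind odd) => // a b; rewrite oddM => -> ->.
have unitN (u : R) : is_unit u -> u ^+ N = 1.
  move=> /ordU[m [[_ um _] odd_m le_mn]]; rewrite /N.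
  rewrite (bigD1 (Ordinal (le_mn : m < n.+1)%N)) //=.
  by rewrite exprM um expr1n.
have unit1 : @is_unit R (-1) by exists (-1); rewrite mulrNN mulr1.
have char2 : 2 \in [pchar R].
  by apply: pchar2P; rewrite -{2}(unitN _ unit1) -signr_odd odd_N expr1 subrr.
have red (y : R) : y * y = 0 -> y = 0.
  move=> yy0; have sq : (1 + y) ^+ 2 = 1.
    by rewrite expr2 mulrDl mul1r mulrDr mulr1 yy0 addr0 -addrA (addrr_pchar2 char2) addr0.
  have /unitN : is_unit (1 + y) by apply: exp_eq1_is_unit sq.
  rewrite -(odd_double_half N) odd_N -mul2n exprD exprM sq expr1n mulr1 expr1.
  by move/eqP; rewrite -subr_eq0 addrC addKr => /eqP.
exists N => // r; have [e [u [ee [uu ->]]]] := clean r; exists e, u.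
by split=> //; [exact: unitN | exact: reduced_idem_central].
Qed.

Theorem theorem2p15 (R : nzRingType) (n : nat) (hn : odd n) :
  [<-> strongly_n_torsion_clean R n; cond2 R n; cond3 R n].
Proof.
tfae.
- move=> [n_gt0 sntc_n min_n]; have [L c2] := sntc_cond2 hn sntc_n.
  have [L_gt0 sntc_L min_L] := cond2_sntc c2.
  suff -> : n = L by [].
  by apply/eqP; rewrite eqn_leq min_n // min_L.
- exact: cond2_cond3.
- move=> c3; have [N odd_N sntc_N] := cond3_sntc c3.
  have [L c2] := sntc_cond2 odd_N sntc_N.
  have odd_L : odd L by have [ks [_ ks_gt0 -> _]] := c2; exact: lcm_mersenne_odd.
  have [_ ordU' [v [uv ord_v]]] := cond2_cond3 odd_L c2.
  have [_ ordU [u [uu ord_u]]] := c3.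
  suff -> : n = L by exact: cond2_sntc.
  have order_uniq (w : R) a b : unit_order w a -> unit_order w b -> a = b.
    move=> ord_a ord_b; have [[a_gt0 wa min_a] [b_gt0 wb min_b]] := (ord_a, ord_b).
    by apply/eqP; rewrite eqn_leq min_a ?min_b.
  (* Both [n] and [L] are orders of units and both bound all such orders, so each is at most the
     other. *)
  have [m [/(order_uniq _ _ _ ord_u) <- _ le_nL]] := ordU' u uu.
  have [m' [/(order_uniq _ _ _ ord_v) <- _ le_Ln]] := ordU v uv.
  by apply/eqP; rewrite eqn_leq le_nL.
Qed.
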